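(* Let $\dot x=B(t)x+s(t)$, $t\in I=(\tau,\infty)$, be a nonautonomous compartmental system with $d$ pools (see context), and fix a solution $t\mapsto(x_1(t),\dots,x_d(t))$ with positive entries. For $i\in\{1,\dots,d\}$ let $p_i(a,t)$ be the density function on age $a$ for the mass in pool $i$ at time $t$, whose evolution is given by the McKendrick--von Förster equation (see context); note that $\int_0^\infty p_i(a,t)\,\mathrm{d}a=x_i(t)$. Define the mean age of mass in pool $i$ by $$\bar a_i(t)=\frac{\int_0^\infty a\,p_i(a,t)\,\mathrm{d}a}{\int_0^\infty p_i(a,t)\,\mathrm{d}a}\quad\text{for all } i\in\{1,\dots,d\}.$$ Then the mean ages $\bar a(t)=(\bar a_1(t),\dots,\bar a_d(t))$ solve the ordinary differential equation $$\dot{\bar a}=g(t,x,\bar a),$$ with $$g_i(t,x,\bar a)=1+\frac{\sum_{j=1}^d(\bar a_j-\bar a_i)\,b_{ij}(t)\,x_j(t)-\bar a_i\,s_i(t)}{x_i(t)}\quad\text{for all } i\in\{1,\dots,d\}.$$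
   Context: Nonautonomous compartmental system: $I=(\tau,\infty)$ with $\tau\in\{-\infty\}\cup\mathbb{R}$; $B:I\to\mathbb{R}^{d\times d}$ is a bounded continuous function whose values are invertible matrices; $s:I\to[0,\infty)^d$ is bounded and continuous; the entries $b_{ij}(t)$ of $B(t)$ satisfy $b_{ii}(t)<0$ for all $i$ and $t\in I$, $b_{ij}(t)\ge 0$ for all $i\ne j$ and $t\in I$, and $\sum_{i=1}^d b_{ij}(t)\le 0$ for all $j$ and $t\in I$. The system is the differential equation $\dot x=B(t)x+s(t)$, where $x_i(t)$ is the mass in pool $i$ at time $t$. Age means the time since the mass entered the system. The age densities $p_i(a,t)$ evolve according to the McKendrick--von Förster equation $$\frac{\partial p_i}{\partial t}+\frac{\partial p_i}{\partial a}=\sum_{j=1}^d b_{ij}(t)p_j,\qquad i\in\{1,\dots,d\},$$ with boundary condition $p_i(0,t)=s_i(t)$, together with a specified initial age distribution. *)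

(* Defs.v *)
From HB Require Import structures.
From mathcomp Require Import all_boot all_order all_algebra.
From mathcomp Require Import all_classical all_reals all_analysis.

Set Implicit Arguments.
Unset Strict Implicit.
Unset Printing Implicit Defensive.

Import Order.TTheory GRing.Theory Num.Theory.
Import numFieldNormedType.Exports.

Local Open Scope classical_set_scope.
Local Open Scope ring_scope.

Definition time_interval (R : realType) (tau : \bar R) : set R :=
  [set t | (tau < t%:E)%E].

Record compartmental_system (R : realType) (d : nat) (tau : \bar R)
    (B : R -> 'M[R]_d) (s : R -> 'cV[R]_d) : Prop := {
  cs_tau : (tau < +oo)%E;
  cs_B_cont : forall t, time_interval tau t -> {for t, continuous B};
  cs_B_bounded : [bounded B t | t in time_interval tau];
  cs_B_unit : forall t, time_interval tau t -> B t \in unitmx;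
  cs_s_cont : forall t, time_interval tau t -> {for t, continuous s};
  cs_s_bounded : [bounded s t | t in time_interval tau];
  cs_s_ge0 : forall t i, time_interval tau t -> 0 <= s t i 0;
  cs_B_diag : forall t i, time_interval tau t -> B t i i < 0;
  cs_B_offdiag : forall t i j, time_interval tau t -> i != j -> 0 <= B t i j;
  cs_B_colsum : forall t j, time_interval tau t -> \sum_i B t i j <= 0
}.

Definition solves_system (R : realType) (d : nat) (tau : \bar R)
    (B : R -> 'M[R]_d) (s x : R -> 'cV[R]_d) : Prop :=
  forall t : R, time_interval tau t -> is_derive t 1 x (B t *m x t + s t).

(* Solution [p i a t] on ages [a >= 0] and times [t >= t0], with distribution
   [p0] at time [t0]; values of [p] outside this quadrant are irrelevant.

   The operator d/dt + d/da is the derivative in the direction (1, 1): the two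
   coincide when [p i] is differentiable (see [McKendrick_operatorE]), but as
   [s] is only continuous and [p0] is arbitrary, the separate partial
   derivatives need not exist (for d = 1 and constant B = - k, one has
   p(a, t) = exp (- k a) s(t - a) for a < t - t0), and [p] may jump across the
   characteristic a = t - t0.  Accordingly the boundary and initial values are
   attained along characteristics. [p0] is not constrained at age 0, where the
   boundary condition fixes [p i 0 t0]. *)
Record McKendrick_solution (R : realType) (d : nat) (t0 : R)
    (B : R -> 'M[R]_d) (s : R -> 'cV[R]_d)
    (p0 : 'I_d -> R -> R) (p : 'I_d -> R -> R -> R) : Prop := {
  mck_transport : forall (i : 'I_d) (a t : R), 0 < a -> t0 < t ->
    is_derive ((a, t) : R * R) ((1, 1) : R * R)
      (fun z : R * R => p i z.1 z.2) (\sum_j B t i j * p j a t);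
  mck_boundary : forall (i : 'I_d) (t : R), t0 <= t -> p i 0 t = s t i 0;
  mck_initial : forall (i : 'I_d) (a : R), 0 < a -> p i a t0 = p0 i a;
  mck_continuous : forall (i : 'I_d) (a t : R), 0 <= a -> t0 <= t ->
    p i (a + h) (t + h) @[h --> 0^'+] --> p i a t
}.

Lemma McKendrick_operatorE (R : realType) (f : R -> R -> R) (a t : R) :
  differentiable (fun z : R * R => f z.1 z.2) (a, t) ->
  is_derive ((a, t) : R * R) ((1, 1) : R * R) (fun z : R * R => f z.1 z.2)
    ((fun u => f a u)^`()%classic t + (fun b => f b t)^`()%classic a).
Proof.
move=> df; split.
  exact: diff_derivable.
have E1 : (fun u => f a u)^`()%classic t
        = 'D_((0, 1) : R * R) (fun z : R * R => f z.1 z.2) (a, t).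
  rewrite derive1E /derive; set g1 := (X in X @ _).
  set g2 := (X in _ = lim (X @ _)).
  suff -> : g1 = g2 by [].
  by apply/funext => h; rewrite /g1 /g2 /= scaler0 add0r.
have E2 : (fun b => f b t)^`()%classic a
        = 'D_((1, 0) : R * R) (fun z : R * R => f z.1 z.2) (a, t).
  rewrite derive1E /derive; set g1 := (X in X @ _).
  set g2 := (X in _ = lim (X @ _)).
  suff -> : g1 = g2 by [].
  by apply/funext => h; rewrite /g1 /g2 /= scaler0 add0r.
rewrite E1 E2 !deriveE// -linearD; congr ('d _ _ _).
by congr pair; rewrite /= ?add0r ?addr0.
Qed.

Definition age_density (R : realType) (d : nat) (t0 : R)
    (x : R -> 'cV[R]_d) (p : 'I_d -> R -> R -> R) : Prop :=
  forall (i : 'I_d) (t : R), t0 <= t ->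
    [/\ forall a, 0 <= a -> 0 <= p i a t,
        (@lebesgue_measure R).-integrable `[0, +oo[ (fun a => (p i a t)%:E) &
        \int[@lebesgue_measure R]_(a in `[0, +oo[) p i a t = x t i 0].

(* [Rintegral] is 0 when the first moment is infinite.  Finite first moments at
   time t0 suffice to exclude this for all t >= t0: as the column sums of [B]
   are <= 0, \sum_j p j is nonincreasing along characteristics. *)
Definition mean_age (R : realType) (d : nat) (p : 'I_d -> R -> R -> R)
    (t : R) : 'cV[R]_d :=
  \col_i ((\int[@lebesgue_measure R]_(a in `[0, +oo[) (a * p i a t)) /
          (\int[@lebesgue_measure R]_(a in `[0, +oo[) p i a t)).

Definition mean_age_field (R : realType) (d : nat)
    (B : R -> 'M[R]_d) (s : R -> 'cV[R]_d)
    (t : R) (x abar : 'cV[R]_d) : 'cV[R]_d :=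
  \col_i (1 + (\sum_j (abar j 0 - abar i 0) * B t i j * x j 0
               - abar i 0 * s t i 0) / x i 0).

(* Main.v *)
(* Along a characteristic (a + h, t + h) the densities solve the linear system
   q' = B q, and as the column sums of B are <= 0 their sum is nonincreasing.
   Hence p_i (a + h) (t + h) - p_i a t - h \sum_j b_ij p_j a t is bounded by
   h o(1) \sum_j p_j a t, uniformly in the age a.  With M_i the first age moment,
     M_i (t + h) = \int_0^h a p_i a (t + h) + \int_0^oo (a + h) p_i (a + h) (t + h),
   where the first integral is O(h ^ 2) because the mass younger than h is bounded
   by the input; integrating the estimate gives M_i' = x_i + \sum_j b_ij M_j.  The
   estimate holds between any two times close to t, so M_i is strictly
   differentiable, which yields the left derivative as well.  The mean age is the
   quotient M_i / x_i. *)

Require Import Defs.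
From HB Require Import structures.
From mathcomp Require Import all_boot all_order all_algebra.
From mathcomp Require Import all_classical all_reals all_analysis.
From mathcomp Require Import measurable_realfun ring lra.

Import Order.TTheory GRing.Theory Num.Theory.
Import numFieldNormedType.Exports.

Local Open Scope classical_set_scope.
Local Open Scope ring_scope.

Set Implicit Arguments.
Unset Strict Implicit.
Unset Printing Implicit Defensive.

Local Notation mu := lebesgue_measure.

(** * Analysis on the half-line: translated integrals, age-weighted integrals, a mean value
    theorem *)

Lemma lebesgue_measure_shift (R : realType) (h : R) (A : set R) :
  measurable A ->
  pushforward lebesgue_measure (shift h : _ -> measurableTypeR R) A
  = lebesgue_measure A.
Proof.
move=> mA; apply/esym/lebesgue_measure_unique => //=.
  exact: measurable_funD.
move=> mh _ [[a b]] _ <-; rewrite /pushforward /=.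
have -> : shift h @^-1` `]a, b]%classic = `](a - h), (b - h)]%classic.
  apply/seteqP; split => x /=; rewrite !in_itv /= => /andP[];
  by rewrite ?ltrBlDr ?lerBrDr => -> ->.
rewrite !lebesgue_measure_itv /= !lte_fin ltrD2r.
by case: ifP => // _; rewrite -!EFinD; congr EFin; ring.
Qed.

Lemma ge0_integral_shift (R : realType) (h : R) (D : set R) (f : R -> \bar R) :
  measurable D -> measurable_fun D f -> (forall x, D x -> (0 <= f x)%E) ->
  (\int[lebesgue_measure]_(x in D) f x =
   \int[lebesgue_measure]_(x in shift h @^-1` D) f (x + h)%R)%E.
Proof.
move=> mD mf f0.
have mh : measurable_fun setT (shift h : measurableTypeR R -> measurableTypeR R).
  exact: measurable_funD.
rewrite -(ge0_integral_pushforward mh)//; last by move=> x /set_mem; exact: f0.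
by apply: eq_measure_integral => //= A mA _; exact/esym/lebesgue_measure_shift.
Qed.

(** Splitting the ages at [h] separates the mass that entered during the last [h] units of time from
    the older mass, whose ages are translated back to [[0, +oo[]. *)
Lemma ge0_integral_shift_itv (R : realType) (h : R) (f : R -> R) :
  0 <= h -> measurable_fun (`[0, +oo[ : set R) f ->
  (forall x : R, 0 <= x -> 0 <= f x) ->
  (\int[lebesgue_measure]_(x in `[0%R, +oo[) (f x)%:E =
   \int[lebesgue_measure]_(x in `[0%R, h[) (f x)%:E +
   \int[lebesgue_measure]_(x in `[0%R, +oo[) (f (x + h)%R)%:E)%E.
Proof.
move=> h0 mf f0.
have mg : measurable_fun (`[h, +oo[ : set R) f.
  apply: measurable_funS mf => //.
  by apply: subset_itvr; rewrite bnd_simp.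
have itvE : `[0, +oo[%classic = `[0, h[%classic `|` `[h, +oo[%classic :> set R.
  by rewrite -itv_bndbnd_setU// bnd_simp.
rewrite [in LHS]itvE ge0_integral_setU//=.
- congr (_ + _)%E.
  rewrite (@ge0_integral_shift _ h)//=.
  + congr (integral _ _ _); apply/seteqP; split => x /=; rewrite !in_itv/= !andbT;
    by rewrite lerDr.
  + exact/measurable_EFinP.
  + move=> x; rewrite in_itv/= andbT => hx.
    by rewrite lee_fin f0// (le_trans h0).
- by apply/measurable_EFinP; move: mf; rewrite itvE.
- move=> x xh; have : (`[0, +oo[%classic : set R) x by rewrite itvE.
  rewrite /= ?in_itv => /andP[x0 _]; by rewrite lee_fin f0.
- apply/disj_setPS => y [/=]; rewrite !in_itv/= => /andP[_ yx] /andP[].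
  by rewrite leNgt yx.
Qed.

Lemma measurable_fun_shift_itv (R : realType) (h : R) (f : R -> R) :
  0 <= h -> measurable_fun (`[0, +oo[ : set R) f ->
  measurable_fun (`[0, +oo[ : set R) (fun x => f (x + h)).
Proof.
move=> h0 mf; apply: (@measurable_comp _ _ _ _ _ _ (`[0, +oo[ : set R) f) => //.
  move=> _ [x /= + <-]; rewrite !in_itv/= !andbT => x0.
  by rewrite addr_ge0.
exact: measurable_funD.
Qed.

Lemma integrable_shift_itv (R : realType) (h : R) (f : R -> R) :
  0 <= h -> (forall x : R, 0 <= x -> 0 <= f x) ->
  (@mu R).-integrable `[0, +oo[ (fun x => (f x)%:E) ->
  (@mu R).-integrable `[0, +oo[ (fun x => (f (x + h))%:E).
Proof.
move=> h0 f0 /integrableP[mf fi].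
have mf' : measurable_fun (`[0, +oo[ : set R) f by apply/measurable_EFinP.
apply/integrableP; split.
  by apply/measurable_EFinP; apply: measurable_fun_shift_itv.
apply: le_lt_trans fi.
have -> : (\int[@mu R]_(x in `[0%R, +oo[) `|(f x)%:E| =
    \int[@mu R]_(x in `[0%R, +oo[) (f x)%:E)%E.
  by apply: eq_integral => x; rewrite inE/= in_itv/= andbT => x0; rewrite ger0_norm ?f0.
rewrite (ge0_integral_shift_itv h0 mf' f0).
have -> : (\int[@mu R]_(x in `[0%R, +oo[) `|(f (x + h)%R)%:E| =
    \int[@mu R]_(x in `[0%R, +oo[) (f (x + h)%R)%:E)%E.
  apply: eq_integral => x; rewrite inE/= in_itv/= andbT => x0.
  by rewrite ger0_norm ?f0 ?addr_ge0.
rewrite leeDr// integral_ge0// => x; rewrite /= in_itv/= => /andP[x0 _].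
by rewrite lee_fin f0.
Qed.

Lemma Rintegral_shift_itv (R : realType) (h : R) (f : R -> R) :
  0 <= h -> (forall x : R, 0 <= x -> 0 <= f x) ->
  (@mu R).-integrable `[0, +oo[ (fun x => (f x)%:E) ->
  \int[@mu R]_(x in `[0, +oo[) f x =
  \int[@mu R]_(x in `[0, h[) f x + \int[@mu R]_(x in `[0, +oo[) f (x + h).
Proof.
move=> h0 f0 fi.
have mf : measurable_fun (`[0, +oo[ : set R) f.
  by case/integrableP: fi => /measurable_EFinP.
rewrite /Rintegral (ge0_integral_shift_itv h0 mf f0) fineD//.
- apply: integrable_fin_num => //; apply: integrableS fi => //.
  by apply: subset_itvl; rewrite bnd_simp.
- by apply: integrable_fin_num => //; apply: integrable_shift_itv.
Qed.

(** This carries integrability forward in time: with [f] taken at the later time and [h] the elapsed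
    time, the bounded part on [[0, h[] has finite integral, and the translated rest is dominated by
    [g], taken at the earlier time. *)
Lemma integrable_of_shift (R : realType) (h c : R) (f g : R -> R) :
  0 <= h -> measurable_fun (`[0, +oo[ : set R) f ->
  (forall x : R, 0 <= x -> 0 <= f x) ->
  (forall x : R, 0 <= x < h -> f x <= c) ->
  (forall x : R, 0 <= x -> f (x + h) <= g x) ->
  (@mu R).-integrable `[0, +oo[ (fun x => (g x)%:E) ->
  (@mu R).-integrable `[0, +oo[ (fun x => (f x)%:E).
Proof.
move=> h0 mf f0 fc fg gi; apply/integrableP; split; first exact/measurable_EFinP.
have -> : (\int[@mu R]_(x in `[0%R, +oo[) `|(f x)%:E| =
    \int[@mu R]_(x in `[0%R, +oo[) (f x)%:E)%E.
  by apply: eq_integral => x; rewrite inE/= in_itv/= andbT => x0; rewrite ger0_norm ?f0.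
rewrite (ge0_integral_shift_itv h0 mf f0); apply: lte_add_pinfty.
  have : (\int[@mu R]_(x in `[0%R, h[) c%:E < +oo)%E.
    rewrite integral_cst//= lebesgue_measure_itv/=.
    by case: ifP => _; rewrite ?mule0// -EFinB -EFinM ltry.
  apply: le_lt_trans; apply: ge0_le_integral => //.
  - by move=> x; rewrite /= in_itv/= => /andP[x0 _]; rewrite lee_fin f0.
  - apply/measurable_EFinP; apply: measurable_funS mf => //.
    by apply: subset_itvl; rewrite bnd_simp.
move/integrableP : gi => [mg]; apply: le_lt_trans.
apply: ge0_le_integral => //.
- by move=> x; rewrite /= in_itv/= andbT => x0; rewrite lee_fin f0// addr_ge0.
- by apply/measurable_EFinP; apply: measurable_fun_shift_itv.
- exact: measurableT_comp.
- move=> x; rewrite /= in_itv/= andbT => x0; rewrite lee_fin.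
  by rewrite (le_trans (fg _ x0))// ler_norm.
Qed.

Lemma integrable_lincomb d (T : measurableType d) (R : realType)
    (m : {measure set T -> \bar R}) (n : nat) (c : 'I_n -> R)
    (f : 'I_n -> T -> R) (D : set T) :
  measurable D ->
  (forall i, (m).-integrable D (fun x => (f i x)%:E)) ->
  (m).-integrable D (fun x => (\sum_i c i * f i x)%:E).
Proof.
move=> mD fi; under eq_fun do rewrite -sumEFin.
apply: integrable_sum => // i _; under eq_fun do rewrite EFinM.
exact: integrableZl.
Qed.

Lemma Rintegral_lincomb d (T : measurableType d) (R : realType)
    (m : {measure set T -> \bar R}) (n : nat) (c : 'I_n -> R)
    (f : 'I_n -> T -> R) (D : set T) :
  measurable D ->
  (forall i, (m).-integrable D (fun x => (f i x)%:E)) ->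
  \int[m]_(x in D) (\sum_i c i * f i x) =
  \sum_i c i * \int[m]_(x in D) f i x.
Proof.
move=> mD; elim: n c f => [|n IH] c f fi.
  under eq_Rintegral do rewrite big_ord0.
  by rewrite big_ord0 Rintegral_cst// mul0r.
under eq_Rintegral do rewrite big_ord_recl.
rewrite RintegralD//.
- rewrite big_ord_recl (RintegralZl _ mD (fi ord0)); congr (_ + _).
  exact: (IH (fun i => c (lift ord0 i)) (fun i => f (lift ord0 i))).
- rewrite /comp; under eq_fun do rewrite EFinM.
  exact: integrableZl.
- exact: integrable_lincomb.
Qed.

Lemma integrable_shifted_weight (R : realType) (h : R) (f : R -> R) :
  (@mu R).-integrable `[0, +oo[ (fun x => (f x)%:E) ->
  (@mu R).-integrable `[0, +oo[ (fun x => (x * f x)%:E) ->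
  (@mu R).-integrable `[0, +oo[ (fun x => ((x + h) * f x)%:E).
Proof.
move=> fi xfi.
have -> : (fun x => ((x + h) * f x)%:E) =
          (fun x => (x * f x)%:E + h%:E * (f x)%:E)%E.
  by apply/funext => x; rewrite mulrDl EFinD EFinM.
by apply: integrableD => //; exact: integrableZl.
Qed.

Lemma Rintegral_shifted_weight (R : realType) (h : R) (f : R -> R) :
  (@mu R).-integrable `[0, +oo[ (fun x => (f x)%:E) ->
  (@mu R).-integrable `[0, +oo[ (fun x => (x * f x)%:E) ->
  \int[@mu R]_(x in `[0, +oo[) ((x + h) * f x) =
  \int[@mu R]_(x in `[0, +oo[) (x * f x) + h * \int[@mu R]_(x in `[0, +oo[) f x.
Proof.
move=> fi xfi; under [in LHS]eq_Rintegral do rewrite mulrDl.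
rewrite RintegralD ?RintegralZl//.
exact: (integrableZl _ _ fi).
Qed.

(** Here [f] is a density at the later time, [g] its prediction from the earlier time and [e] the
    error at each age. After the split at age [h], the older part compares [(x + h) * f (x + h)]
    with [(x + h) * g x]; hence the weight [x + h] on both [g] and [e]. *)
Lemma moment_increment (R : realType) (h C : R) (f g e : R -> R) :
  0 <= h ->
  (forall x : R, 0 <= x -> 0 <= f x) ->
  (forall x : R, 0 <= x < h -> f x <= C) ->
  (forall x : R, 0 <= x -> `|f (x + h) - g x| <= e x) ->
  (@mu R).-integrable `[0, +oo[ (fun x => (x * f x)%:E) ->
  (@mu R).-integrable `[0, +oo[ (fun x => (g x)%:E) ->
  (@mu R).-integrable `[0, +oo[ (fun x => (x * g x)%:E) ->
  (@mu R).-integrable `[0, +oo[ (fun x => (e x)%:E) ->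
  (@mu R).-integrable `[0, +oo[ (fun x => (x * e x)%:E) ->
  `|\int[@mu R]_(x in `[0, +oo[) (x * f x)
    - (\int[@mu R]_(x in `[0, +oo[) (x * g x)
       + h * \int[@mu R]_(x in `[0, +oo[) g x)|
  <= C * h ^+ 2 + (\int[@mu R]_(x in `[0, +oo[) (x * e x)
                   + h * \int[@mu R]_(x in `[0, +oo[) e x).
Proof.
move=> h0 f0 fC fge xfi gi xgi ei xei.
have xf0 x : 0 <= x -> 0 <= x * f x by move=> x0; rewrite mulr_ge0 ?f0.
have xfhi := integrable_shift_itv h0 xf0 xfi.
rewrite (Rintegral_shift_itv h0 xf0 xfi) -!Rintegral_shifted_weight// -addrA.
apply: le_trans (ler_normD _ _) _; apply: lerD.
  rewrite ger0_norm; last first.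
    by apply: Rintegral_ge0 => x; rewrite /= in_itv/= => /andP[x0 _]; exact: xf0.
  have itvE : h = fine (@mu R `[0, h[).
    rewrite lebesgue_measure_itv/= lte_fin; case: ltP => /= [_|hle].
      by rewrite subr0.
    by apply/le_anti; rewrite h0 hle.
  (* Below age [h] the weight is at most [h] and the density at most [C], on an interval of length
     [h]: this is the term [C * h ^+ 2]. *)
  apply: (@le_trans _ _ (\int[@mu R]_(x in `[0, h[) (C * h))); last first.
    by rewrite Rintegral_cst// -itvE -mulrA.
  apply: le_Rintegral => //.
  - apply: integrableS xfi => //.
    by apply: subset_itvl; rewrite bnd_simp.
  - apply: measurable_bounded_integrable => //.
      by rewrite /= lebesgue_measure_itv/=; case: ifP => _; rewrite -?EFinB ltry.
    exists `|C * h|; split; first exact: num_real.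
    by move=> y Cy x _; rewrite ltW.
  - move=> x; rewrite /= in_itv/= => /andP[x0 xh]; rewrite mulrC.
    by apply: ler_pM => //; rewrite ?f0 ?fC ?x0 ?ltW.
have di : (@mu R).-integrable `[0, +oo[
    (fun x => ((x + h) * f (x + h) - (x + h) * g x)%:E).
  by apply: (integrableB _ xfhi (integrable_shifted_weight h gi xgi)).
rewrite -RintegralB//=; last exact: integrable_shifted_weight.
apply: le_trans (le_normr_Rintegral _ _) _ => //=.
apply: le_Rintegral => //=.
- exact: integrable_norm.
- exact: integrable_shifted_weight.
- move=> x; rewrite /= in_itv/= andbT => x0.
  have xh0 : 0 <= x + h by rewrite addr_ge0.
  by rewrite -mulrBr normrM (ger0_norm xh0) ler_wpM2l// fge.
Qed.

(** A characteristic may start on the boundary of the quadrant, where the transport equation is not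
    assumed; there only the limit from the right is available. *)
Lemma MVT_right_continuous (R : realType) (f df : R -> R) (h : R) :
  0 < h -> (forall x : R, 0 < x -> is_derive x 1 f (df x)) ->
  f x @[x --> 0^'+] --> f 0 ->
  exists2 x, 0 < x < h & f h - f 0 = h * df x.
Proof.
move=> h0 fdf f0.
have cf (x : R) : 0 < x -> {for x, continuous f}.
  by move=> /fdf[dx _]; exact/differentiable_continuous/derivable1_diffP.
have [||x] := @MVT _ f df 0 h h0.
- by move=> x; rewrite in_itv/= => /andP[x0 _]; exact: fdf.
- apply/continuous_within_itvP => //; split => //.
    by move=> x; rewrite in_itv/= => /andP[x0 _]; exact: cf.
  exact/cvg_at_left_filter/cf.
by rewrite in_itv/= subr0 mulrC => xh fE; exists x.
Qed.

(** * Estimates along characteristics *)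

Section characteristics.
Context (R : realType) (d : nat) (tau : \bar R)
  (B : R -> 'M[R]_d) (s : R -> 'cV[R]_d)
  (t0 : R) (p0 : 'I_d -> R -> R) (p : 'I_d -> R -> R -> R)
  (hsys : compartmental_system tau B s)
  (ht0 : time_interval tau t0)
  (hp : McKendrick_solution t0 B s p0 p)
  (p_ge0 : forall (i : 'I_d) (a t : R), 0 <= a -> t0 <= t -> 0 <= p i a t).

Lemma time_interval_ge (t : R) : t0 <= t -> time_interval tau t.
Proof. by move=> t0t; rewrite /time_interval/= (lt_le_trans ht0). Qed.

(** The difference quotients are those of the derivative in direction [(1, 1)] at [(a + h, t + h)].
    As [h] is positive, this point lies in the open quadrant even if [a = 0] or [t = t0]. *)
Lemma characteristic_derive (i : 'I_d) (a t h : R) :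
  0 <= a -> t0 <= t -> 0 < h ->
  is_derive h 1 (fun u => p i (a + u) (t + u))
    (\sum_j B (t + h) i j * p j (a + h) (t + h)).
Proof.
move=> a0 t0t h0.
have ah : 0 < a + h by rewrite ltr_wpDl.
have th : t0 < t + h by rewrite (le_lt_trans t0t)// ltrDl.
have [D1 D2] := mck_transport hp i ah th.
set f := (fun z : R * R => p i z.1 z.2) in D1 D2.
have E : (fun u : R => u^-1 *: (((fun u => p i (a + u) (t + u)) \o shift h) (u *: 1)
           - p i (a + h) (t + h))) =
         (fun u : R => u^-1 *: ((f \o shift (a + h, t + h)) (u *: ((1, 1) : R * R))
           - f (a + h, t + h))).
  apply/funext => u; rewrite /f/=.
  by congr (_ *: (p i _ _ - _)); rewrite addrCA.
split; first by rewrite /derivable E.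
by rewrite -D2 /derive E.
Qed.

Lemma characteristic_cvg (i : 'I_d) (a t : R) : 0 <= a -> t0 <= t ->
  p i (a + u) (t + u) @[u --> 0^'+] --> p i (a + 0) (t + 0).
Proof. by move=> a0 t0t; rewrite !addr0; exact: (mck_continuous hp). Qed.

Lemma characteristic_MVT (i : 'I_d) (a t h : R) :
  0 <= a -> t0 <= t -> 0 < h -> exists2 u, 0 < u < h &
  p i (a + h) (t + h) - p i a t = h * \sum_j B (t + u) i j * p j (a + u) (t + u).
Proof.
move=> a0 t0t h0.
have [||u uh] := @MVT_right_continuous _ (fun u => p i (a + u) (t + u))
  (fun u => \sum_j B (t + u) i j * p j (a + u) (t + u)) _ h0.
- by move=> u; exact: characteristic_derive.
- exact: characteristic_cvg.
by rewrite /= !addr0 => ->; exists u.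
Qed.

(** By the mean value theorem the increment is [h] times the sum over [j] of the [j]-th column sum
    of [B] times [p j], taken at an intermediate point; column sums are nonpositive and densities
    nonnegative. *)
Lemma total_density_nincr (a t h : R) : 0 <= a -> t0 <= t -> 0 <= h ->
  \sum_i p i (a + h) (t + h) <= \sum_i p i a t.
Proof.
move=> a0 t0t; rewrite le_eqVlt => /predU1P[<-|h0]; first by rewrite !addr0.
have [||u /andP[u0 uh]] := @MVT_right_continuous _ (fun u => \sum_i p i (a + u) (t + u))
  (fun u => \sum_i \sum_j B (t + u) i j * p j (a + u) (t + u)) _ h0.
- move=> u u0; rewrite (_ : (fun u : R => _) = \sum_i (fun u => p i (a + u) (t + u))).
    by apply: is_derive_sum => i; exact: characteristic_derive.
  by apply/funext => x; rewrite fct_sumE.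
- apply: (@cvg_big R 'I_d +%R 0 xpredT) => [|i _].
    exact: add_continuous.
  exact: characteristic_cvg.
under [X in _ - X]eq_bigr do rewrite !addr0.
have au : 0 <= a + u by rewrite addr_ge0// ltW.
have tu : t0 <= t + u by rewrite (le_trans t0t)// lerDl ltW.
rewrite -subr_le0 => ->; rewrite pmulr_rle0// exchange_big/= sumr_le0// => j _.
rewrite -mulr_suml mulr_le0_ge0 ?p_ge0//.
by apply: (cs_B_colsum hsys); exact: time_interval_ge.
Qed.

Lemma density_le_total (i : 'I_d) (a t : R) : 0 <= a -> t0 <= t ->
  p i a t <= \sum_j p j a t.
Proof.
move=> a0 t0t; rewrite (bigD1 i)//= lerDl sumr_ge0// => j _; exact: p_ge0.
Qed.

Lemma density_shift_le (i : 'I_d) (a t h : R) : 0 <= a -> t0 <= t -> 0 <= h ->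
  p i (a + h) (t + h) <= \sum_j p j a t.
Proof.
move=> a0 t0t h0; apply: le_trans (total_density_nincr a0 t0t h0).
by apply: density_le_total; rewrite ?addr_ge0// (le_trans t0t)// lerDl.
Qed.

(** Mass of age [a <= t - t0] entered at time [t - a]. Following the characteristic back to age 0,
    the total density there is the total input. *)
Lemma young_density_le (C : R) (i : 'I_d) (a t : R) :
  (forall u, t0 <= u -> \sum_j s u j 0 <= C) ->
  0 <= a -> t0 <= t - a -> p i a t <= C.
Proof.
move=> sC a0 ta; have := @density_shift_le i 0 (t - a) a (lexx _) ta a0.
rewrite add0r subrK => /le_trans; apply.
by under eq_bigr do rewrite (mck_boundary hp _ ta); exact: sC.
Qed.

(* This estimate and the next are relative to the total density at the earlier
   time, so that they can be integrated against the age weight. *)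
Lemma characteristic_lipschitz (beta : R) (i : 'I_d) (a t h : R) :
  (forall u j, t0 <= u -> `|B u i j| <= beta) ->
  0 <= a -> t0 <= t -> 0 <= h ->
  `|p i (a + h) (t + h) - p i a t| <= h * beta * \sum_j p j a t.
Proof.
move=> Bb a0 t0t; rewrite le_eqVlt => /predU1P[<-|h0].
  by rewrite !addr0 subrr normr0 !mul0r.
have [u /andP[u0 uh] ->] := characteristic_MVT i a0 t0t h0.
have au : 0 <= a + u by rewrite addr_ge0// ltW.
have tu : t0 <= t + u by rewrite (le_trans t0t)// lerDl ltW.
rewrite normrM gtr0_norm// -mulrA ler_wpM2l ?(ltW h0)//.
apply: le_trans (ler_norm_sum _ _ _) _.
apply: (@le_trans _ _ (\sum_j beta * p j (a + u) (t + u))).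
  apply: ler_sum => j _; rewrite normrM (ger0_norm (p_ge0 _ au tu)).
  by rewrite ler_wpM2r ?p_ge0 ?Bb.
rewrite -mulr_sumr ler_wpM2l//; first by rewrite (le_trans _ (Bb _ i tu)).
exact: (total_density_nincr a0 t0t (ltW u0)).
Qed.

Lemma characteristic_first_order (beta eps : R) (b : 'I_d -> R) (i : 'I_d) (a t h : R) :
  (forall u i j, t0 <= u -> `|B u i j| <= beta) ->
  (forall j, `|b j| <= beta) ->
  (forall u j, t <= u <= t + h -> `|B u i j - b j| <= eps) ->
  0 <= a -> t0 <= t -> 0 <= h ->
  `|p i (a + h) (t + h) - (p i a t + h * \sum_j b j * p j a t)|
  <= h * (eps + d%:R * beta ^+ 2 * h) * \sum_j p j a t.
Proof.
move=> Bb bb Be a0 t0t; rewrite le_eqVlt => /predU1P[<-|h0].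
  by rewrite !addr0 !mul0r addr0 subrr normr0.
have [u /andP[u0 uh] pE] := characteristic_MVT i a0 t0t h0.
have au : 0 <= a + u by rewrite addr_ge0// ltW.
have tu : t0 <= t + u by rewrite (le_trans t0t)// lerDl ltW.
have b0 : 0 <= beta by rewrite (le_trans _ (bb i)).
have e0 : 0 <= eps.
  by rewrite (le_trans _ (Be t i _))// lexx lerDl ltW.
set S := \sum_j p j a t.
have S0 : 0 <= S by apply: sumr_ge0 => j _; exact: p_ge0.
rewrite opprD addrA pE -mulrBr normrM gtr0_norm// -mulrA ler_wpM2l ?(ltW h0)//.
rewrite -sumrB.
(* The error has two sources. Replacing the rates by [b] costs [eps] times the total density;
   replacing the densities at [a + u] by those at [a] costs, by the Lipschitz estimate, at most
   [beta * (h * beta)] times the total density for each of the [d] pools. *)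
have -> : \sum_j (B (t + u) i j * p j (a + u) (t + u) - b j * p j a t) =
  \sum_j (B (t + u) i j - b j) * p j (a + u) (t + u) +
  \sum_j b j * (p j (a + u) (t + u) - p j a t).
  by rewrite -big_split/=; apply: eq_bigr => j _; ring.
rewrite (le_trans (ler_normD _ _))// mulrDl lerD//.
  apply: le_trans (ler_norm_sum _ _ _) _.
  apply: (@le_trans _ _ (\sum_j eps * p j (a + u) (t + u))).
    apply: ler_sum => j _; rewrite normrM (ger0_norm (p_ge0 _ au tu)).
    by rewrite ler_wpM2r ?p_ge0// Be// lerDl ltW//= lerD2l ltW.
  rewrite -mulr_sumr ler_wpM2l//.
  exact: (total_density_nincr a0 t0t (ltW u0)).
apply: le_trans (ler_norm_sum _ _ _) _.
apply: (@le_trans _ _ (\sum_(j < d) beta * (h * beta * S))).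
  apply: ler_sum => j _; rewrite normrM ler_pM//.
  apply: le_trans (characteristic_lipschitz _ a0 t0t (ltW u0)) _.
    by move=> v k; exact: Bb.
  by rewrite ler_wpM2r// ler_wpM2r// ltW.
rewrite sumr_const card_ord -mulr_natl.
by rewrite le_eqVlt; apply/orP; left; apply/eqP; ring.
Qed.

End characteristics.

(** * Entrywise derivatives, strict differentiability and entrywise bounds *)

Lemma is_derive_mxP (R : realFieldType) (V : normedModType R) (m n : nat)
    (M : V -> 'M[R]_(m, n)) (t v : V) (D : 'M[R]_(m, n)) :
  is_derive t v M D <->
  (forall i j, is_derive t v (fun u => M u i j) (D i j)).
Proof.
split=> [[dM <-] i j|dM].
  by split; [move/derivable_mxP: dM; exact|rewrite derive_mx// mxE].
have dM' : derivable M t v by apply/derivable_mxP => i j; case: (dM i j).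
split=> //; rewrite derive_mx//; apply/matrixP => i j; rewrite mxE.
by case: (dM i j).
Qed.

Lemma is_derive_continuous (R : realType) (f : R -> R) (t D : R) :
  is_derive t 1 f D -> {for t, continuous f}.
Proof. by case=> dx _; exact/differentiable_continuous/derivable1_diffP. Qed.

(** Only forward steps are controlled, but their starting point may lie on either side of [t]. A
    quotient with increment [k > 0] uses the step from [t] to [t + k]; one with [k < 0] uses the
    step of length [- k] from [t + k] to [t]. *)
Lemma strict_derivative (R : realType) (f : R -> R) (t D : R) :
  (forall e : R, 0 < e -> exists2 r : R, 0 < r &
     forall u h, 0 < h -> t - r < u -> u + h < t + r ->
     `|f (u + h) - f u - h * D| <= h * e) ->
  is_derive t 1 f D.
Proof.
move=> fD.
have cf : (fun k : R => k^-1 *: ((f \o shift t) (k *: 1) - f t)) @ 0^' --> D.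
  apply/cvgrPdist_le => /= e e0; have [r r0 fr] := fD _ e0.
  have quot (k : R) : k != 0 ->
      `|D - k^-1 *: (f (k *: 1 + t) - f t)| =
      `|f (t + k) - f t - k * D| / `|k|.
    move=> k0; rewrite -normfV -normrM -normrN; congr (`|_|).
    by rewrite [k *: 1]mulr1 [k + t]addrC -[k^-1 *: _]/(k^-1 * _); field.
  near=> k.
  have k0 : k != 0 by near: k; exact: nbhs_dnbhs_neq.
  have kr : `|k| < r by near: k; exact: dnbhs0_lt.
  rewrite quot// ler_pdivrMr ?normr_gt0// [leRHS]mulrC.
  have [kp|kn] := ltP 0 k.
    rewrite (gtr0_norm kp) in kr *.
    by apply: fr => //; rewrite ?ltrBlDr ?ltrD2l// ltrDl.
  have {k0}kn : k < 0 by rewrite lt_neqAle k0.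
  rewrite (ltr0_norm kn) in kr *.
  have := fr (t + k) (- k); rewrite oppr_gt0 kn addrK -(ltrN2 r) opprK in kr *.
  rewrite ltrD2l => /(_ isT); rewrite kr ltrDl r0 => /(_ isT isT).
  by rewrite mulNr opprK -normrN !opprD !opprK -addrA addrCA addrA.
split; first by apply/cvg_ex; exists D.
exact: cvg_lim cf.
Unshelve. all: by end_near. Qed.

Lemma mx_entry_le_norm (R : realDomainType) (m n : nat) (A : 'M[R]_(m, n)) i j :
  `|A i j| <= `|A|.
Proof.
rewrite [leRHS]/Num.Def.normr/= mx_normrE.
exact: (le_bigmax _ (fun ij => `|A ij.1 ij.2|) (i, j)).
Qed.

Lemma bounded_mx_entries (R : realFieldType) (T : Type) (D : set T) (m n : nat)
    (A : T -> 'M[R]_(m, n)) :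
  [bounded A t | t in D] ->
  exists2 K : R, 0 < K & forall t i j, D t -> `|A t i j| <= K.
Proof.
move=> /pinfty_ex_gt0[K K0 AK]; exists K => // t i j Dt.
exact: le_trans (mx_entry_le_norm _ _ _) (AK t Dt).
Qed.

(** * First age moments: finiteness, continuity and evolution *)

Section age_moments.
Context (R : realType) (d : nat) (tau : \bar R)
  (B : R -> 'M[R]_d) (s x : R -> 'cV[R]_d)
  (t0 : R) (p0 : 'I_d -> R -> R) (p : 'I_d -> R -> R -> R)
  (hsys : compartmental_system tau B s)
  (hx : solves_system tau B s x)
  (ht0 : time_interval tau t0)
  (hp0 : forall i : 'I_d, (@mu R).-integrable `[0, +oo[
           (fun a => (a * p0 i a)%:E))
  (hp : McKendrick_solution t0 B s p0 p)
  (hdens : age_density t0 x p).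

Definition age_moment (t : R) (i : 'I_d) : R :=
  \int[@mu R]_(a in `[0, +oo[) (a * p i a t).

Lemma density_ge0 (i : 'I_d) (a t : R) : 0 <= a -> t0 <= t -> 0 <= p i a t.
Proof. by move=> a0 t0t; have [+ _ _] := hdens i t0t; exact. Qed.

Lemma density_integrable (i : 'I_d) (t : R) : t0 <= t ->
  (@mu R).-integrable `[0, +oo[ (fun a => (p i a t)%:E).
Proof. by move=> t0t; have [_ + _] := hdens i t0t. Qed.

Lemma Rintegral_density (i : 'I_d) (t : R) : t0 <= t ->
  \int[@mu R]_(a in `[0, +oo[) p i a t = x t i 0.
Proof. by move=> t0t; have [_ _] := hdens i t0t. Qed.

Lemma pool_ge0 (i : 'I_d) (t : R) : t0 <= t -> 0 <= x t i 0.
Proof.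
move=> t0t; rewrite -(Rintegral_density i t0t); apply: Rintegral_ge0 => a.
by rewrite /= in_itv/= andbT => a0; exact: density_ge0.
Qed.

Lemma age_moment_ge0 (i : 'I_d) (t : R) : t0 <= t -> 0 <= age_moment t i.
Proof.
move=> t0t; apply: Rintegral_ge0 => a.
by rewrite /= in_itv/= andbT => a0; rewrite mulr_ge0// density_ge0.
Qed.

Lemma input_bounded :
  exists2 C : R, 0 < C & forall t, t0 <= t -> \sum_i s t i 0 <= C.
Proof.
have [K K0 sK] := bounded_mx_entries (cs_s_bounded hsys).
(* The summand 1 keeps the bound positive even when [d = 0]. *)
exists (d%:R * K + 1); first by rewrite ltr_wpDl// mulr_ge0// ltW.
move=> t t0t; apply: (@le_trans _ _ (\sum_(i < d) K)).
  apply: ler_sum => i _; apply: le_trans (ler_norm _) (sK _ _ _ _).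
  exact: time_interval_ge ht0 _ t0t.
by rewrite sumr_const card_ord mulr_natl lerDl.
Qed.

Lemma initial_moment_integrable (i : 'I_d) :
  (@mu R).-integrable `[0, +oo[ (fun a => (a * p i a t0)%:E).
Proof.
(* The values [p i a t0] and [p0 i a] may differ at age 0, where the weight [a] vanishes. *)
apply: eq_integrable (hp0 i) => //= a; rewrite inE/= in_itv/= andbT le_eqVlt.
by move=> /predU1P[<-|a0]; rewrite ?mul0r// (mck_initial hp).
Qed.

Lemma density_lincomb_integrable (c : 'I_d -> R) (t : R) : t0 <= t ->
  (@mu R).-integrable `[0, +oo[ (fun a => (\sum_j c j * p j a t)%:E).
Proof.
by move=> t0t; apply: integrable_lincomb => // i; exact: density_integrable.
Qed.

Lemma moment_lincomb_integrable (c : 'I_d -> R) (t : R) :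
  (forall i, (@mu R).-integrable `[0, +oo[ (fun a => (a * p i a t)%:E)) ->
  (@mu R).-integrable `[0, +oo[ (fun a => (a * \sum_j c j * p j a t)%:E).
Proof.
move=> pi.
rewrite (_ : (fun a => _) = (fun a => (\sum_j c j * (a * p j a t))%:E)).
  exact: (@integrable_lincomb _ _ _ (@mu R) _ c (fun i (a : R) => a * p i a t)).
apply/funext => a; congr EFin; rewrite mulr_sumr.
by apply: eq_bigr => j _; rewrite mulrCA.
Qed.

(** Ages below [t - t0] carry a density bounded by the input. Older mass was present at [t0], so its
    density is dominated by the total density at [t0], whose first moment is finite by [hp0]. The
    coefficients 1 put this total in the form of a linear combination. *)
Lemma moment_integrable (i : 'I_d) (t : R) : t0 <= t ->
  (@mu R).-integrable `[0, +oo[ (fun a => (a * p i a t)%:E).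
Proof.
move=> t0t; have [C C0 sC] := input_bounded.
have h0 : 0 <= t - t0 by rewrite subr_ge0.
apply: (@integrable_of_shift _ (t - t0) ((t - t0) * C) _
  (fun a => (a + (t - t0)) * \sum_j 1 * p j a t0)) => //.
- apply: measurable_funM => //.
  by case/integrableP: (density_integrable i t0t) => /measurable_EFinP.
- by move=> a a0; rewrite mulr_ge0// density_ge0.
- move=> a /andP[a0 ah]; apply: ler_pM => //; rewrite ?density_ge0 ?(ltW ah)//.
  apply: (young_density_le hsys ht0 hp density_ge0 i sC) => //.
  by rewrite lerBrDr -lerBrDl ltW.
- move=> a a0; have := density_shift_le hsys ht0 hp density_ge0 i a0 (lexx t0) h0.
  rewrite [t0 + _]addrC subrK => pS.
  have ah : 0 <= a + (t - t0) by exact: addr_ge0.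
  apply: ler_pM => //; first exact: density_ge0.
  by apply: le_trans pS _; apply: ler_sum => j _; rewrite mul1r.
- apply: integrable_shifted_weight.
    exact: density_lincomb_integrable.
  by apply: moment_lincomb_integrable; exact: initial_moment_integrable.
Qed.

Lemma Rintegral_density_lincomb (c : 'I_d -> R) (t : R) : t0 <= t ->
  \int[@mu R]_(a in `[0, +oo[) (\sum_j c j * p j a t) = \sum_j c j * x t j 0.
Proof.
move=> t0t; rewrite Rintegral_lincomb//; last first.
  by move=> i; exact: density_integrable.
by apply: eq_bigr => j _; rewrite Rintegral_density.
Qed.

Lemma Rintegral_moment_lincomb (c : 'I_d -> R) (t : R) : t0 <= t ->
  \int[@mu R]_(a in `[0, +oo[) (a * \sum_j c j * p j a t) =
  \sum_j c j * age_moment t j.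
Proof.
move=> t0t; rewrite -Rintegral_lincomb//; last first.
  by move=> i; exact: moment_integrable.
apply: eq_Rintegral => a _; rewrite mulr_sumr.
by apply: eq_bigr => j _; rewrite mulrCA.
Qed.

(** The coefficients [c] predict the density of pool [i] after a step [h], with an error relative to
    the total density. Three predictions are used: zero for boundedness of the moments, the current
    density of pool [i] for the Lipschitz bound, and its first-order expansion for the
    derivative. *)
Lemma age_moment_increment (C K : R) (c : 'I_d -> R) (i : 'I_d) (t h : R) :
  (forall u, t0 <= u -> \sum_j s u j 0 <= C) ->
  t0 <= t -> 0 <= h ->
  (forall a, 0 <= a -> `|p i (a + h) (t + h) - \sum_j c j * p j a t|
                       <= K * \sum_j p j a t) ->
  `|age_moment (t + h) i
    - (\sum_j c j * age_moment t j + h * \sum_j c j * x t j 0)|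
  <= C * h ^+ 2 + K * (\sum_j age_moment t j + h * \sum_j x t j 0).
Proof.
move=> sC t0t h0 pc.
have th : t0 <= t + h by rewrite (le_trans t0t)// lerDl.
have := @moment_increment R h C (p i ^~ (t + h))
  (fun a => \sum_j c j * p j a t) (fun a => \sum_j K * p j a t) h0.
rewrite !Rintegral_moment_lincomb// !Rintegral_density_lincomb//.
rewrite -!mulr_sumr [h * (K * _)]mulrCA -mulrDr; apply.
- by move=> a a0; exact: density_ge0.
- move=> a /andP[a0 ah].
  apply: (young_density_le hsys ht0 hp density_ge0 i sC) => //.
  by rewrite (le_trans t0t)// -addrA lerDl subr_ge0 ltW.
- by move=> a a0; rewrite -mulr_sumr; exact: pc.
- exact: moment_integrable.
- exact: density_lincomb_integrable.
- by apply: moment_lincomb_integrable => j; exact: moment_integrable.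
- exact: density_lincomb_integrable.
- by apply: moment_lincomb_integrable => j; exact: moment_integrable.
Qed.

(** Kronecker weights express [p i] itself as a linear combination of all densities, as
    [age_moment_increment] requires. *)
Lemma sum_delta (y : 'I_d -> R) (i : 'I_d) : \sum_j (j == i)%:R * y j = y i.
Proof.
rewrite (bigD1 i)//= eqxx mul1r big1 ?addr0// => j /negbTE ->.
by rewrite mul0r.
Qed.

Lemma sum_delta_add (h : R) (b y : 'I_d -> R) (i : 'I_d) :
  \sum_j ((j == i)%:R + h * b j) * y j = y i + h * \sum_j b j * y j.
Proof.
rewrite mulr_sumr -(sum_delta y i) -big_split/=.
by apply: eq_bigr => j _; rewrite mulrDl mulrA.
Qed.

Lemma rates_bounded :
  exists2 beta : R, 0 < beta & forall t i j, t0 <= t -> `|B t i j| <= beta.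
Proof.
have [K K0 BK] := bounded_mx_entries (cs_B_bounded hsys).
by exists K => // t i j t0t; apply: BK; exact: time_interval_ge ht0 _ t0t.
Qed.

Lemma pool_derive (i : 'I_d) (t : R) : t0 <= t ->
  is_derive t 1 (fun u => x u i 0) (\sum_j B t i j * x t j 0 + s t i 0).
Proof.
move=> t0t; have /is_derive_mxP/(_ i 0) := hx (time_interval_ge ht0 t0t).
by rewrite !mxE.
Qed.

Lemma pools_bounded (T : R) : t0 <= T ->
  exists2 X : R, 0 <= X & forall t, t0 <= t <= T -> \sum_i x t i 0 <= X.
Proof.
move=> t0T; have [|c cT cmax] := @EVT_max R (fun t => \sum_i x t i 0) _ _ t0T.
  apply/subspace_continuousP => t; rewrite /= in_itv/= => /andP[t0t _].
  apply: cvg_within_filter.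
  apply: (@cvg_big R 'I_d +%R 0 xpredT) => [|i _]; first exact: add_continuous.
  exact: is_derive_continuous (pool_derive i t0t).
exists (\sum_i x c i 0) => [|t tT]; last by apply: cmax; rewrite in_itv.
apply: sumr_ge0 => i _; apply: pool_ge0.
by move: cT; rewrite in_itv => /andP[].
Qed.

(** Continuity of the moments rests on this bound, so compactness cannot be used. Instead a single
    step from [t0] to [t] is made with prediction zero: each density is at most the total density at
    [t0] on the same characteristic. *)
Lemma age_moments_bounded (T : R) : t0 <= T ->
  exists2 K : R, 0 <= K & forall t, t0 <= t <= T -> \sum_i age_moment t i <= K.
Proof.
move=> t0T; have [C C0 sC] := input_bounded.
set SM := \sum_j age_moment t0 j; set SX := \sum_j x t0 j 0.
have SM0 : 0 <= SM by apply: sumr_ge0 => j _; exact: age_moment_ge0.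
have SX0 : 0 <= SX by apply: sumr_ge0 => j _; exact: pool_ge0.
have T0 : 0 <= T - t0 by rewrite subr_ge0.
pose K := C * (T - t0) ^+ 2 + (SM + (T - t0) * SX).
have K0 : 0 <= K by rewrite !addr_ge0 ?mulr_ge0 ?sqr_ge0// ltW.
exists (\sum_(i < d) K) => [|t /andP[t0t tT]]; first by apply: sumr_ge0.
apply: ler_sum => i _.
have h0 : 0 <= t - t0 by rewrite subr_ge0.
have hT : t - t0 <= T - t0 by rewrite lerD2r.
have := @age_moment_increment C 1 (fun=> 0) i t0 (t - t0) sC (lexx _) h0.
rewrite [t0 + _]addrC subrK => /(_ _)/le_trans H.
apply: le_trans (ler_norm _) _.
have Z (y : 'I_d -> R) : \sum_j 0 * y j = 0 by apply: big1 => j _; rewrite mul0r.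
rewrite !Z mulr0 addr0 subr0 in H; apply: H; last first.
  rewrite mul1r lerD ?ler_wpM2l ?ler_pXn2r ?nnegrE ?(ltW C0)//.
  by rewrite lerD2l ler_wpM2r.
move=> a a0; rewrite Z subr0 mul1r.
have at0 : 0 <= a + (t - t0) by rewrite addr_ge0.
rewrite ger0_norm ?density_ge0//.
have := density_shift_le hsys ht0 hp density_ge0 i a0 (lexx t0) h0.
by rewrite [t0 + _]addrC subrK.
Qed.

Lemma age_moment_lipschitz (T : R) : t0 <= T -> exists2 L : R, 0 < L &
  forall i t h, t0 <= t -> 0 <= h -> t + h <= T ->
  `|age_moment (t + h) i - age_moment t i| <= h * L.
Proof.
move=> t0T; have [C C0 sC] := input_bounded.
have [beta b0 Bb] := rates_bounded.
have [X X0 xX] := pools_bounded t0T.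
have [K K0 mK] := age_moments_bounded t0T.
have T0 : 0 <= T - t0 by rewrite subr_ge0.
(* Here [X] accounts for the aging of the mass in the pool, [C * (T - t0)] for the young mass, and
   the [beta] term for exchange between pools along characteristics; the summand 1 makes the
   constant positive. *)
exists (1 + (X + C * (T - t0) + beta * (K + (T - t0) * X))).
  move: (T - t0) T0 => l l0; have [C0' b0'] := (ltW C0, ltW b0).
  by rewrite ltr_pwDl// !(addr_ge0, mulr_ge0).
move=> i t h t0t h0 thT.
have tT : t0 <= t <= T by rewrite t0t (le_trans _ thT)// lerDl.
have hT : h <= T - t0 by rewrite lerBrDl (le_trans _ thT)// lerD2r.
have := @age_moment_increment C (h * beta) (fun j => (j == i)%:R) i t h sC t0t h0.
rewrite !sum_delta => H.
have {}H : `|age_moment (t + h) i - (age_moment t i + h * x t i 0)|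
    <= C * h ^+ 2 + h * beta * (\sum_j age_moment t j + h * \sum_j x t j 0).
  apply: H => a a0; rewrite sum_delta.
  by apply: (characteristic_lipschitz hsys ht0 hp density_ge0) => // u j; exact: Bb.
have xi : 0 <= x t i 0 <= X.
  rewrite pool_ge0//= (le_trans _ (xX _ tT))// (bigD1 i)//= lerDl sumr_ge0// => j _.
  exact: pool_ge0.
have -> : age_moment (t + h) i - age_moment t i =
   (age_moment (t + h) i - (age_moment t i + h * x t i 0)) + h * x t i 0 by ring.
apply: le_trans (ler_normD _ _) _.
have -> : `|h * x t i 0| = h * x t i 0.
  by rewrite ger0_norm// mulr_ge0//; case/andP: xi.
have SM : \sum_j age_moment t j + h * \sum_j x t j 0 <= K + (T - t0) * X.
  rewrite lerD ?mK// ler_pM ?xX//.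
  by apply: sumr_ge0 => j _; exact: pool_ge0.
apply: (@le_trans _ _ (C * h ^+ 2 + h * beta * (K + (T - t0) * X) + h * X)).
  apply: lerD; last by rewrite ler_wpM2l//; case/andP: xi.
  apply: le_trans H _; rewrite lerD2l ler_wpM2l// mulr_ge0// ltW//.
have -> : C * h ^+ 2 + h * beta * (K + (T - t0) * X) + h * X
  = h * (X + C * h + beta * (K + (T - t0) * X)) by ring.
rewrite ler_wpM2l// ler_wpDl// lerD2r lerD2l ler_wpM2l// ltW//.
Qed.

Lemma age_moment_continuous (i : 'I_d) (t e : R) : t0 <= t -> 0 < e ->
  exists2 r : R, 0 < r & forall u, t0 <= u -> `|u - t| < r ->
  `|age_moment u i - age_moment t i| <= e.
Proof.
move=> t0t e0; have t01 : t0 <= t + 1 by rewrite (le_trans t0t)// lerDl.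
have [L L0 ML] := age_moment_lipschitz t01.
(* Radius at most 1 keeps [u] below [t + 1], where the Lipschitz constant [L] is valid. *)
exists (Num.min 1 (e / L)); first by rewrite lt_min ltr01 divr_gt0.
move=> u t0u; rewrite lt_min ltr_pdivlMr// => /andP[u1 ueL].
have [tu|ut] := leP t u.
  have h0 : 0 <= u - t by rewrite subr_ge0.
  have := ML i t (u - t) t0t h0; rewrite [t + _]addrC subrK => H.
  rewrite (ger0_norm h0) in u1 ueL.
  apply: le_trans (H _) (ltW ueL).
  by rewrite -lerBlDl ltW.
have h0 : 0 <= t - u by rewrite subr_ge0 ltW.
have := ML i u (t - u) t0u h0; rewrite [u + _]addrC subrK => H.
rewrite distrC (ger0_norm h0) in u1 ueL.
rewrite distrC; apply: le_trans (H _) (ltW ueL).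
by rewrite lerDl.
Qed.

Let M := age_moment.

Lemma age_moment_derive (i : 'I_d) (t : R) : t0 < t ->
  is_derive t 1 (fun u => M u i) (x t i 0 + \sum_j B t i j * M t j).
Proof.
move=> t0t; apply: strict_derivative => eta eta0.
have [C C0 sC] := input_bounded.
have [beta b0 Bb] := rates_bounded.
have t0T : t0 <= t + 1 by rewrite (le_trans (ltW t0t))// lerDl.
have [X X0 xX] := pools_bounded t0T.
have [K K0 mK] := age_moments_bounded t0T.
(* The summands are, in order, the coefficients of [eps] in the bounds for the young mass, the
   first-order error along characteristics, the change of the moments, the change of the pool
   content, and the second-order term [h * V]. *)
pose A := C + (1 + d%:R * beta ^+ 2) * (K + X) + d%:R * beta + 1 + beta * X.
have A0 : 0 < A.
  rewrite /A -!addrA ltr_pwDl//; have b0' := ltW b0.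
  by rewrite !(addr_ge0, mulr_ge0, sqr_ge0).
pose eps := Num.min 1 (eta / A).
have e0 : 0 < eps by rewrite lt_min ltr01 divr_gt0.
have e1 : eps <= 1 by rewrite ge_min lexx.
have eA : eps * A <= eta by rewrite -ler_pdivlMr// ge_min lexx orbT.
have Ball i' j' : \forall u \near t, `|B u i' j' - B t i' j'| <= eps.
  have cB : {for t, continuous (fun u => B u i' j')}.
    have cBt := cs_B_cont hsys (time_interval_ge ht0 (ltW t0t)).
    exact: (continuous_comp cBt (@coord_continuous _ _ _ i' j' _)).
  move/cvgrPdist_le : cB => /(_ _ e0); apply: filterS => u /=.
  by rewrite distrC.
have xall j' : \forall u \near t, `|x u j' 0 - x t j' 0| <= eps.
  have := is_derive_continuous (pool_derive j' (ltW t0t)).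
  move/cvgrPdist_le => /(_ _ e0); apply: filterS => u /=.
  by rewrite distrC.
have Mall j' : \forall u \near t, t0 <= u -> `|M u j' - M t j'| <= eps.
  have [r r0 Mr] := age_moment_continuous j' (ltW t0t) e0.
  by near=> u => t0u; apply: Mr => //; rewrite distrC; near: u; exact: cvgr_dist_lt.
have : \forall u \near t, [/\ t0 < u, forall i' j', `|B u i' j' - B t i' j'| <= eps,
    forall j', `|x u j' 0 - x t j' 0| <= eps &
    forall j', t0 <= u -> `|M u j' - M t j'| <= eps].
  near=> u; split.
  - by near: u; exact: lt_nbhsr.
  - by near: u; apply: filter_forall => i'; apply: filter_forall => j'; exact: Ball.
  - by near: u; exact: filter_forall.
  - by near: u; exact: filter_forall.
move=> /nbhs_ballP[r /= r0 rP].
(* The bound [r] keeps the whole step in the ball where the local estimates hold; [eps / 2] on each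
   side of [t] gives [h <= eps]. *)
exists (Num.min r (eps / 2)); first by rewrite lt_min r0 divr_gt0.
move=> u h h0 tu uht.
(* The whole step is covered because the first-order estimate compares the rates at all intermediate
   times. *)
have P v : u <= v <= u + h -> [/\ t0 < v, forall i' j', `|B v i' j' - B t i' j'| <= eps,
    forall j', `|x v j' 0 - x t j' 0| <= eps &
    forall j', t0 <= v -> `|M v j' - M t j'| <= eps].
  move=> /andP[uv vu]; apply: rP; rewrite /ball/= distrC ltr_distl.
  have mr : Num.min r (eps / 2) <= r by rewrite ge_min lexx.
  by apply/andP; split; lra.
have me : Num.min r (eps / 2) <= eps / 2 by rewrite ge_min lexx orbT.
have he : h <= eps by lra.
have [t0u Bu xu Mu] : [/\ t0 < u, forall i' j', `|B u i' j' - B t i' j'| <= eps,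
    forall j', `|x u j' 0 - x t j' 0| <= eps &
    forall j', t0 <= u -> `|M u j' - M t j'| <= eps].
  by apply: P; rewrite lexx lerDl ltW.
have uT : t0 <= u <= t + 1 by rewrite (ltW t0u)/=; lra.
have h0' := ltW h0; have b0' := ltW b0; have e0' := ltW e0.
(* The rates are frozen at [t] although the step starts at [u]: the limit in strict
   differentiability must not depend on the step. *)
have := @age_moment_increment C
  (h * (eps + d%:R * beta ^+ 2 * h))
  (fun j => (j == i)%:R + h * B t i j) i u h sC (ltW t0u) h0'.
rewrite !(sum_delta_add h (fun j => B t i j)) => H.
set SM := \sum_j age_moment u j in H.
set SX := \sum_j x u j 0 in H.
set W := \sum_j B t i j * age_moment u j in H.
set V := \sum_j B t i j * x u j 0 in H.
set W0 := \sum_j B t i j * M t j.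
have {}H : `|M (u + h) i - (M u i + h * W + h * (x u i 0 + h * V))|
    <= C * h ^+ 2 + h * (eps + d%:R * beta ^+ 2 * h) * (SM + h * SX).
  apply: H => a a0; rewrite (sum_delta_add h (fun j => B t i j)).
  apply: (characteristic_first_order hsys ht0 hp density_ge0) => //.
  - by move=> j; apply: Bb; exact: ltW.
  - by move=> v j uv; have [_ + _ _] := P v uv; exact.
  - exact: ltW.
have SX0 : 0 <= SX by apply: sumr_ge0 => j _; apply: pool_ge0; exact: ltW.
have SM0 : 0 <= SM by apply: sumr_ge0 => j _; apply: age_moment_ge0; exact: ltW.
have SXX : SX <= X by exact: xX.
have SMK : SM <= K by exact: mK.
have WW : `|W - W0| <= d%:R * beta * eps.
  rewrite /W /W0 -sumrB (le_trans (ler_norm_sum _ _ _))//.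
  apply: (@le_trans _ _ (\sum_(j < d) beta * eps)).
    apply: ler_sum => j _; rewrite -mulrBr normrM ler_pM//; last exact/Mu/ltW.
    by apply: Bb; exact: ltW.
  by rewrite sumr_const card_ord -[beta * eps *+ d]mulr_natl mulrA.
have VX : `|V| <= beta * X.
  rewrite /V (le_trans (ler_norm_sum _ _ _))//.
  apply: (@le_trans _ _ (\sum_j beta * x u j 0)).
    apply: ler_sum => j _; rewrite normrM.
    have xj0 : 0 <= x u j 0 by apply: pool_ge0; exact: ltW.
    by rewrite (ger0_norm xj0) ler_wpM2r// Bb// ltW.
  by rewrite -mulr_sumr ler_wpM2l.
(* The first bracket is controlled by [H]. The second moves moments and pool content from [u] to
   [t], and contains [h * V], which comes from the extra [h] in the weight [a + h]. *)
have -> : M (u + h) i - M u i - h * (x t i 0 + W0) =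
  (M (u + h) i - (M u i + h * W + h * (x u i 0 + h * V)))
  + h * ((W - W0) + (x u i 0 - x t i 0) + h * V) by ring.
apply: le_trans (ler_normD _ _) _.
apply: (@le_trans _ _ (h * (eps * A))); last by rewrite ler_wpM2l.
rewrite normrM (ger0_norm h0').
have H1 : `|W - W0 + (x u i 0 - x t i 0) + h * V|
    <= d%:R * beta * eps + eps + eps * (beta * X).
  apply: le_trans (ler_normD _ _) _; apply: lerD.
    by apply: le_trans (ler_normD _ _) _; apply: lerD.
  by rewrite normrM (ger0_norm h0') ler_pM.
(* One factor [h] is kept and the next replaced by [eps]; the [h] before [SX] is absorbed by
   [h <= eps <= 1]. *)
have H2 : C * h ^+ 2 + h * (eps + d%:R * beta ^+ 2 * h) * (SM + h * SX)
    <= h * (C * eps + eps * (1 + d%:R * beta ^+ 2) * (K + X)).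
  rewrite [leRHS]mulrDr; apply: lerD.
    by rewrite expr2 mulrCA ler_wpM2l// ler_wpM2l// ltW.
  have D0 : 0 <= d%:R * beta ^+ 2 by rewrite mulr_ge0 ?sqr_ge0.
  rewrite -[leLHS]mulrA ler_wpM2l//.
  apply: ler_pM.
  - by rewrite addr_ge0// mulr_ge0.
  - by rewrite addr_ge0// mulr_ge0.
  - by rewrite mulrDr mulr1 lerD2l [leRHS]mulrC ler_wpM2l.
  - rewrite lerD//; apply: le_trans SXX; rewrite ler_piMl//.
    exact: le_trans he e1.
apply: (le_trans (lerD (le_trans H H2) (ler_wpM2l h0' H1))).
rewrite -mulrDr ler_wpM2l// /A le_eqVlt; apply/orP; left; apply/eqP; ring.
Unshelve. all: by end_near. Qed.

End age_moments.

(** * Mean ages as quotients of first moments by pool contents *)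

Lemma cvg_mx_entries (R : realFieldType) (T : Type) (F : set_system T) (m n : nat)
    (f : T -> 'M[R]_(m, n)) (A : 'M[R]_(m, n)) : Filter F ->
  (forall i j, f u i j @[u --> F] --> A i j) -> f u @[u --> F] --> A.
Proof.
move=> FF fA; apply/cvgrPdist_le => /= e e0; near=> u.
rewrite /Num.Def.normr/= mx_normrE (bigmax_le _ (ltW e0))//= => i _.
rewrite !mxE/=; move: i; near: u; apply: filter_forall => /= i.
by have /cvgrPdist_le := fA i.1 i.2; exact.
Unshelve. all: by end_near. Qed.

Lemma is_derive_quotient (R : realType) (f g : R -> R) (t df dg : R) :
  g t != 0 -> is_derive t 1 f df -> is_derive t 1 g dg ->
  is_derive t 1 (fun u => f u / g u) (df / g t - f t * dg / g t ^+ 2).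
Proof.
move=> g0 hf [dG <-].
have dV : is_derive t 1 (fun u => (g u)^-1) (- (g t) ^- 2 *: 'D_1 g t).
  by split; [exact: derivableV|exact: deriveV].
apply: is_derive_eq (is_deriveM hf dV) _.
by rewrite -![_ *: _]/(_ * _); ring.
Qed.

(** The right-hand side is the quotient rule for [m i / y i 0] when [m i] has derivative
    [y i 0 + \sum_j B t i j * m j] and [y] follows the system. The two sides agree because the mean
    age of pool [j] times [y j 0] is [m j]. *)
Lemma mean_age_fieldE (R : realType) (d : nat) (B : R -> 'M[R]_d)
    (s : R -> 'cV[R]_d) (t : R) (y : 'cV[R]_d) (m : 'I_d -> R) (i : 'I_d) :
  (forall j, y j 0 != 0) ->
  mean_age_field B s t y (\col_j (m j / y j 0)) i 0 =
  (y i 0 + \sum_j B t i j * m j) / y i 0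
  - m i * (\sum_j B t i j * y j 0 + s t i 0) / y i 0 ^+ 2.
Proof.
move=> y0; rewrite !mxE.
have -> : \sum_j ((\col_k (m k / y k 0)) j 0 - m i / y i 0) * B t i j * y j 0
  = \sum_j B t i j * m j - m i / y i 0 * \sum_j B t i j * y j 0.
  rewrite mulr_sumr -sumrB; apply: eq_bigr => j _; rewrite mxE.
  by field; rewrite !y0.
by field; rewrite y0.
Qed.

Unset Implicit Arguments.

(** Continuity up to [t0] ties the differential equation on the open half-line to the initial mean
    ages. *)
Theorem theorem2 (R : realType) (d : nat) (tau : \bar R)
    (B : R -> 'M[R]_d) (s x : R -> 'cV[R]_d)
    (t0 : R) (p0 : 'I_d -> R -> R) (p : 'I_d -> R -> R -> R)
    (hsys : compartmental_system tau B s)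
    (hx : solves_system tau B s x)
    (ht0 : time_interval tau t0)
    (hxpos : forall (t : R) (i : 'I_d), t0 <= t -> 0 < x t i 0)
    (hp0 : forall i : 'I_d, (@lebesgue_measure R).-integrable `[0, +oo[
             (fun a => (a * p0 i a)%:E))
    (hp : McKendrick_solution t0 B s p0 p)
    (hdens : age_density t0 x p) :
  {within `[t0, +oo[, continuous (mean_age p)} /\
  (forall t : R, t0 < t ->
     is_derive t 1 (mean_age p) (mean_age_field B s t (x t) (mean_age p t))).
Proof.
have mean_ageE t : t0 <= t -> mean_age p t = \col_i (age_moment p t i / x t i 0).
  move=> t0t; apply/matrixP => i j; rewrite !mxE.
  by rewrite (Rintegral_density hdens).
split.
  apply/subspace_continuousP => t tA.
  have t0t : t0 <= t by move: tA; rewrite /= in_itv/= andbT.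
  suff : mean_age p u @[u --> within `[t0, +oo[ (nbhs t)] --> mean_age p t by [].
  apply: cvg_mx_entries => i j; rewrite ord1 (mean_ageE t)// [X in _ --> X]mxE.
  (* The quotient formula holds only from [t0] on, so at [t = t0] it can replace [mean_age] only
     along the filter restricted to [[t0, +oo[]. *)
  have E : {near within `[t0, +oo[ (nbhs t),
      (fun u => age_moment p u i / x u i 0) =1 (fun u => mean_age p u i 0)}.
    apply: filterS (withinT _ (nbhs_filter t)) => u tu.
    have t0u : t0 <= u by move: tu; rewrite /= in_itv/= andbT.
    by rewrite mean_ageE// mxE.
  apply: cvg_trans (near_eq_cvg E) _; apply: cvgM.
    apply/cvgrPdist_le => e e0.
    have [r r0 Mr] := age_moment_continuous hsys hx ht0 hp0 hp hdens i t0t e0.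
    rewrite near_withinE; apply/nbhs_ballP; exists r => //= u.
    rewrite /ball/= in_itv/= andbT => tu t0u.
    by rewrite distrC; apply: Mr => //; rewrite distrC.
  apply: cvgV; first by rewrite gt_eqF// hxpos.
  apply: cvg_within_filter.
  exact: is_derive_continuous (pool_derive hx ht0 i t0t).
move=> t t0t; apply/is_derive_mxP => i j; rewrite ord1 mean_ageE ?ltW//.
have xt0 k : x t k 0 != 0 by rewrite gt_eqF// hxpos// ltW.
rewrite mean_age_fieldE//.
(* As [t0 < t], the quotient formula holds on a full neighbourhood of [t]. *)
apply: (@near_eq_is_derive _ _ _ (fun u => age_moment p u i / x u i 0)).
  near=> u; have t0u : t0 < u by near: u; exact: lt_nbhsr.
  by rewrite mean_ageE ?mxE// ltW.
apply: is_derive_quotient => //.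
  exact: (age_moment_derive hsys hx ht0 hp0 hp hdens).
exact: (pool_derive hx ht0 i (ltW t0t)).
Unshelve. all: by end_near. Qed.
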